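(* Let $F$ be a CNF formula given with a total order of its variables and a total order of its clauses (both denoted $<$). Suppose at least one of the following obstructions is present: (Left obstruction) there are variables $x<z$ and clauses $A<C$ such that $x$ appears in $C$, $z$ appears in $A$, and $z$ does not appear in $C$; (Right obstruction) there are variables $x<y<z$ and clauses $A<B<C$ such that $x$ appears in $C$, $z$ appears in $A$, $y$ does not appear in $C$, and $z$ does not appear in $B$. Then the two orders cannot be merged into an interval ordering of $F$; that is, there is no interval ordering of the variables and clauses of $F$ whose restrictions to the variables and to the clauses are the two given orders.
   Context: A variable appears in a clause if it occurs there as a positive or negative literal. An interval ordering (interval bigraph ordering) of a CNF formula is a total order $<$ on the union of its variables and clauses such that for every variable $x$ appearing in a clause $C$: (1) if $x'$ is a variable and $x<x'<C$ then $x'$ also appears in $C$; and (2) if $C'$ is a clause and $C<C'<x$ then $x$ also appears in $C'$. *)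

(* Defs.v *)
From mathcomp Require Import all_boot.
From mathcomp Require Import finmap.

Set Implicit Arguments.
Unset Strict Implicit.
Unset Printing Implicit Defensive.

Local Open Scope fset_scope.

(* [(x, true)] is the positive literal of [x], [(x, false)] the negative one. *)
Definition literal (V : choiceType) : choiceType := (V * bool)%type.

Definition clause (V : choiceType) : choiceType := {fset literal V}.

(* A sequence, so that a formula may be read as a set (no repetition) or as a
   multiset of clauses; the order of the sequence itself is irrelevant. *)
Definition cnf (V : choiceType) : Type := seq (clause V).

Definition appears (V : choiceType) (x : V) (C : clause V) : bool :=
  ((x, true) \in C) || ((x, false) \in C).

Definition vars (V : choiceType) (F : cnf V) : {fset V} :=
  \bigcup_(C <- F) [fset l.1 | l in C].

Lemma varsP (V : choiceType) (F : cnf V) (x : V) :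
  (x \in vars F) = has (appears x) F.
Proof.
apply/bigfcupP/hasP => [[C /andP[FC _] /imfsetP[[y b] /= lC ->]]|[C FC xC]].
  by exists C => //; rewrite /appears; case: b lC => ->; rewrite ?orbT.
exists C; first by rewrite FC.
by case/orP: xC => lC; apply/imfsetP; [exists (x, true)|exists (x, false)].
Qed.

Definition var_of (V : choiceType) (F : cnf V) : choiceType := vars F.

(* The clauses of [F] are its clause occurrences, named by their positions. *)
Definition cla_of (V : choiceType) (F : cnf V) : choiceType := 'I_(size F).

Definition appears_in (V : choiceType) (F : cnf V) (x : var_of F)
    (C : cla_of F) : bool :=
  appears (val x) (tnth (in_tuple F) C).

Definition strict_total_order (T : eqType) (lt : rel T) : Prop :=
  [/\ irreflexive lt, transitive lt
    & forall a b : T, a != b -> lt a b || lt b a].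

Definition interval_ordering (V : choiceType) (F : cnf V)
    (lt : rel (var_of F + cla_of F)%type) : Prop :=
  strict_total_order lt /\
  forall (x : var_of F) (C : cla_of F), appears_in x C ->
    (forall x' : var_of F,
        lt (inl x) (inl x') -> lt (inl x') (inr C) -> appears_in x' C) /\
    (forall C' : cla_of F,
        lt (inr C) (inr C') -> lt (inr C') (inl x) -> appears_in x C').

Definition left_obstruction (V : choiceType) (F : cnf V)
    (ltV : rel (var_of F)) (ltC : rel (cla_of F)) : Prop :=
  exists (x z : var_of F) (A C : cla_of F),
    ltV x z /\ ltC A C /\
    appears_in x C /\ appears_in z A /\ ~~ appears_in z C.

Definition right_obstruction (V : choiceType) (F : cnf V)
    (ltV : rel (var_of F)) (ltC : rel (cla_of F)) : Prop :=
  exists (x y z : var_of F) (A B C : cla_of F),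
    (ltV x y /\ ltV y z) /\ (ltC A B /\ ltC B C) /\
    appears_in x C /\ appears_in z A /\
    ~~ appears_in y C /\ ~~ appears_in z B.

(* Main.v *)
(** Compare, in the merged order, the clause [C] with [z] (left obstruction) or
    with [y] (right obstruction): if the variable comes first, condition (1) for
    [x] in [C] puts it in [C]; if [C] comes first, condition (2) for [z] in [A]
    puts [z] in [C], respectively in [B]. *)
Require Import Defs.
From mathcomp Require Import all_boot.
From mathcomp Require Import finmap.

Theorem lemma11 (V : choiceType) (F : cnf V)
    (ltV : rel (var_of F)) (ltC : rel (cla_of F))
    (totV : strict_total_order ltV) (totC : strict_total_order ltC)
    (obstr : left_obstruction ltV ltC \/ right_obstruction ltV ltC) :
  ~ (exists lt : rel (var_of F + cla_of F)%type,
      interval_ordering lt /\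
      (forall x y : var_of F, lt (inl x) (inl y) = ltV x y) /\
      (forall C D : cla_of F, lt (inr C) (inr D) = ltC C D)).
Proof.
move=> [lt [[[_ lt_trans lt_total] lt_interval] [ltVE ltCE]]].
case: obstr => [[x [z [A [C [xz [AC [xC [zA]]]]]]]]
  | [x [y [z [A [B [C [[xy yz] [[AB BC] [xC [zA [yC]]]]]]]]]]]].
  (* [isT] suffices since [inl z != inr C] computes to [true]. The last conjunct,
     [~~ appears_in z C], is still in the goal, so the views leave [appears_in z C] to prove on both
     sides. *)
  case/orP: (lt_total (inl z) (inr C) isT) => [zC | Cz]; apply/negP/negPn.
    by apply: (proj1 (lt_interval x C xC)); rewrite ?ltVE.
  by apply: (proj2 (lt_interval z A zA)); rewrite ?ltCE.
case/orP: (lt_total (inl y) (inr C) isT) => [y_lt_C | C_lt_y].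
  case/negP: yC.
  by apply: (proj1 (lt_interval x C xC)); rewrite ?ltVE.
(* Here the pending conjunct is [~~ appears_in z B]. *)
apply/negP/negPn; apply: (proj2 (lt_interval z A zA)); first by rewrite ltCE.
(* Condition (2) also needs [B] before [z], from the chain B < C < y < z across both sorts. *)
apply: (lt_trans (inr C)); first by rewrite ltCE.
by apply: (lt_trans (inl y)); rewrite ?ltVE.
Qed.
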